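(* Let $R$ and $S$ be commutative rings with identity, $f:R\to S$ a ring homomorphism (preserving identities), and $J$ a non-zero proper ideal of $S$ with $J^2=0$. Consider the properties: (a) $Z(R)^2=0$; (b) for every $r\in \mathrm{Reg}(R)$ and every $j\in J\setminus\{0\}$, $jf(r)\neq 0$; (c) for every $r\in Z(R)\setminus\{0\}$ and every $j\in J\setminus\{0\}$, $jf(r)=0$. Then the following conditions are equivalent: (1) $\Gamma(R\bowtie^f J)$ is complete; (2) properties (a), (b) and (c) hold; (3) $Z(R\bowtie^f J)^2=0$.
   Context: The amalgamation of $R$ with $S$ along $J$ with respect to $f$ is the subring $R\bowtie^f J=\{(r,f(r)+j)\mid r\in R,\ j\in J\}$ of $R\times S$. For a commutative ring $A$, $Z(A)$ is the set of zero-divisors of $A$ (including $0$), and $\mathrm{Reg}(A)=A\setminus Z(A)$ is the set of regular elements; $Z(A)^2=0$ means $xy=0$ for all $x,y\in Z(A)$ (including $x=y$). The zero-divisor graph $\Gamma(A)$ is the undirected graph with vertex set $Z(A)\setminus\{0\}$ in which distinct vertices $x,y$ are adjacent if and only if $xy=0$; it is complete if any two distinct vertices are adjacent. *)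

(* Defs.v *)
From HB Require Import structures.
From mathcomp Require Import all_boot all_algebra boolp classical_sets.

Set Implicit Arguments.
Unset Strict Implicit.
Unset Printing Implicit Defensive.

Import GRing.Theory.
Local Open Scope classical_set_scope.
Local Open Scope ring_scope.

Section ZeroDivisors.
Variable A : comNzRingType.

(* As 1 != 0 in A, this set contains 0. *)
Definition zero_divisors : set A := [set x | exists2 y : A, y != 0 & x * y = 0].

Definition regular_elements : set A := ~` zero_divisors.

(* For an ideal X this says that the ideal X^2 is 0, since X^2 is generated by
   the products x * y. *)
Definition square_zero (X : set A) : Prop :=
  forall x y : A, X x -> X y -> x * y = 0.

End ZeroDivisors.

Arguments zero_divisors A : clear implicits.
Arguments regular_elements A : clear implicits.

Record simple_graph (T : Type) := SimpleGraph {
  vertices : set T;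
  adjacent : T -> T -> Prop;
  adjacent_vertices : forall x y, adjacent x y -> vertices x /\ vertices y;
  adjacent_irrefl : forall x, ~ adjacent x x;
  adjacent_sym : forall x y, adjacent x y -> adjacent y x }.

Definition complete_graph (T : Type) (G : simple_graph T) : Prop :=
  forall x y : T, vertices G x -> vertices G y -> x <> y -> adjacent G x y.

Section ZeroDivisorGraph.
Variable A : comNzRingType.

Definition zdg_vertices : set A := zero_divisors A `\ 0.

Definition zdg_adjacent (x y : A) : Prop :=
  [/\ zdg_vertices x, zdg_vertices y, x <> y & x * y = 0].

Fact zdg_adjacent_vertices x y :
  zdg_adjacent x y -> zdg_vertices x /\ zdg_vertices y.
Proof. by case. Qed.

Fact zdg_adjacent_irrefl x : ~ zdg_adjacent x x.
Proof. by case. Qed.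

Fact zdg_adjacent_sym x y : zdg_adjacent x y -> zdg_adjacent y x.
Proof. by case=> Vx Vy xy xy0; split=> //; [apply: nesym | rewrite mulrC]. Qed.

Definition zero_divisor_graph : simple_graph A :=
  SimpleGraph zdg_adjacent_vertices zdg_adjacent_irrefl zdg_adjacent_sym.

End ZeroDivisorGraph.

Arguments zero_divisor_graph A : clear implicits.

(* [idealr S] is the library's type of proper ideals of S. Its elements are
   boolean predicates, which classically (via [asbool]) excludes no ideal. *)
Section Amalgamation.
Variables (R S : comNzRingType) (f : {rmorphism R -> S}) (J : idealr S).

Definition amalg_pred : {pred R * S} :=
  fun x => `[< exists (r : R) (j : S), j \in J /\ x = (r, f r + j) >].

Fact amalg_subring_closed : subring_closed amalg_pred.
Proof.
split.
- by apply/asboolP; exists 1, 0; rewrite rpred0 rmorph1 addr0.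
- move=> _ _ /asboolP[r [j [Jj ->]]] /asboolP[s [k [Jk ->]]].
  apply/asboolP; exists (r - s), (j - k); split; first exact: rpredB.
  by congr pair; rewrite /= rmorphB opprD addrACA.
- move=> _ _ /asboolP[r [j [Jj ->]]] /asboolP[s [k [Jk ->]]].
  apply/asboolP; exists (r * s), (f r * k + (f s + k) * j); split.
    by apply: rpredD; apply: idealMr.
  by congr pair; rewrite /= rmorphM mulrDl mulrDr -addrA [j * _]mulrC.
Qed.

HB.instance Definition _ :=
  GRing.isSubringClosed.Build (R * S)%type amalg_pred amalg_subring_closed.

Record amalg := Amalg { amalg_val : R * S; _ : amalg_val \in amalg_pred }.

HB.instance Definition _ := [isSub for amalg_val].
HB.instance Definition _ := [Choice of amalg by <:].
HB.instance Definition _ := [SubChoice_isSubComNzRing of amalg by <:].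

End Amalgamation.

(* Main.v *)
Require Import Defs.
From mathcomp Require Import all_boot all_algebra boolp classical_sets.

(** Write A for the amalgamation and Z for sets of zero-divisors.

    Graph completeness says that distinct zero-divisors annihilate each other;
    only the squares of zero-divisors escape it.  A nonzero n with n^2 = 0
    recovers them: it shifts a zero-divisor x to the distinct zero-divisor
    x + n, so 0 = x (x + n) = x^2 ([complete_graph_square_zero]).  In A such an
    n is (0, j) with j in J nonzero, because J^2 = 0.  So completeness forces
    Z(A)^2 = 0, and the converse is immediate.

    To compare Z(A)^2 = 0 with (a), (b), (c), one moves zero-divisors between R
    and A.  The diagonal r |-> (r, f r) is an injective ring morphism, so it
    maps Z(R) into Z(A), and all the (0, j) lie in Z(A) as they multiply to 0.
    This gives (a) and (c) at once.  For (b), if j f(r) = 0 with j nonzero,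
    then (r, f r) kills (0, j), so it lies in Z(A) and squares to 0; hence
    r^2 = 0 and r is not regular.  Conversely, (b) is what makes the projection
    A -> R map Z(A) into Z(R) ([zero_divisors_amalg_fst]); then in
    (r, f r + i)(s, f s + j) = (r s, f (r s) + i f s + j f r + i j)
    the terms vanish by (a), (c) and J^2 = 0. *)

Local Open Scope ring_scope.
Import GRing.Theory.

Section ZeroDivisors.
Variable A : comNzRingType.

Lemma zero_divisors_sqr0 (x : A) : x * x = 0 -> zero_divisors A x.
Proof.
move=> xx0; have [->|x0] := eqVneq x 0; last by exists x.
by exists 1; rewrite ?oner_neq0 ?mul0r.
Qed.

Lemma square_zero_complete_graph :
  square_zero (zero_divisors A) -> complete_graph (zero_divisor_graph A).
Proof. by move=> Z0 x y Vx Vy xy; split=> //; apply: Z0; [case: Vx|case: Vy]. Qed.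

(** Without a nilpotent the implication fails for Z/2 x Z/2, whose zero-divisor
    graph is a single edge between two idempotents. Here x + n is a zero-divisor
    as n kills it, and it is distinct from x, so x annihilates it. *)
Lemma complete_graph_square_zero (n : A) : n != 0 -> n * n = 0 ->
  complete_graph (zero_divisor_graph A) -> square_zero (zero_divisors A).
Proof.
move=> n0 nn0 complA.
have mul0 x y : zero_divisors A x -> zero_divisors A y -> x <> y -> x * y = 0.
  move=> Zx Zy xy; have [->|x0] := eqVneq x 0; first by rewrite mul0r.
  have [->|y0] := eqVneq y 0; first by rewrite mulr0.
  by have [] := complA x y (conj Zx (elimN eqP x0)) (conj Zy (elimN eqP y0)) xy.
move=> x y Zx Zy; have [<-{y Zy}|/eqP] := eqVneq x y; last exact: mul0.
have [->//|/eqP xn] := eqVneq x n.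
have xn0 : x * n = 0 by apply: mul0 => //; apply: zero_divisors_sqr0.
have Zxn : zero_divisors A (x + n) by exists n; rewrite // mulrDl xn0 nn0 addr0.
have xDn : x <> x + n.
  by move=> /eqP; rewrite -subr_eq0 opprD addNKr oppr_eq0 (negPf n0).
by have := mul0 _ _ Zx Zxn xDn; rewrite mulrDr xn0 addr0.
Qed.

End ZeroDivisors.

Section Amalgamation.
Variables (R S : comNzRingType) (f : {rmorphism R -> S}) (J : idealr S).
Local Notation A := (amalg f J).

Lemma val_amalg0 : val (0 : A) = (0, 0).
Proof. by rewrite rmorph0. Qed.

Lemma val_amalgM (x y : A) :
  val (x * y) = ((val x).1 * (val y).1, (val x).2 * (val y).2).
Proof. by rewrite rmorphM. Qed.

Lemma amalg_pair_subproof (r : R) (j : S) (Jj : j \in J) :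
  (r, f r + j) \in amalg_pred f J.
Proof. by apply/asboolP; exists r, j. Qed.

Definition amalg_pair r j Jj : A := Amalg (amalg_pair_subproof r j Jj).

Definition amalg_diag r : A := amalg_pair r 0 (rpred0 J).

Definition amalg_ideal j Jj : A := amalg_pair 0 j Jj.

Lemma val_amalg_diag r : val (amalg_diag r) = (r, f r).
Proof. by rewrite /= addr0. Qed.

Lemma val_amalg_ideal j Jj : val (amalg_ideal j Jj) = (0, j).
Proof. by rewrite /= rmorph0 add0r. Qed.

Lemma amalg_ideal_neq0 j Jj : j != 0 -> amalg_ideal j Jj != 0.
Proof.
apply: contra_neq => /(congr1 val).
by rewrite val_amalg_ideal val_amalg0 => -[].
Qed.

Lemma amalg_diagM_ideal r j Jj : j * f r = 0 ->
  amalg_diag r * amalg_ideal j Jj = 0.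
Proof.
move=> jr0; apply: val_inj; rewrite val_amalgM val_amalg0.
by rewrite val_amalg_diag val_amalg_ideal /= mulr0 mulrC jr0.
Qed.

Lemma zero_divisors_amalg_diag r :
  zero_divisors R r -> zero_divisors A (amalg_diag r).
Proof.
case=> s s0 rs0; exists (amalg_diag s).
  apply: contra_neq s0 => /(congr1 val).
  by rewrite val_amalg_diag val_amalg0 => -[].
apply: val_inj; rewrite val_amalgM val_amalg0 !val_amalg_diag /=.
by rewrite -rmorphM rs0 rmorph0.
Qed.

Hypothesis J_sq0 : square_zero [set` J].

Lemma amalg_ideal_sqr0 j Jj : amalg_ideal j Jj * amalg_ideal j Jj = 0.
Proof.
apply: val_inj; rewrite val_amalgM val_amalg0 !val_amalg_ideal /=.
by rewrite mulr0 (J_sq0 j j).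
Qed.

(** If x kills y = (s, f s + j), then s witnesses that the first component r
    of x is a zero-divisor, unless s = 0; in that case J^2 = 0 turns x y = 0
    into j f(r) = 0 with j nonzero. *)
Lemma zero_divisors_amalg_fst (x : A) :
  (forall (r : R) (j : S), regular_elements R r ->
     j \in J -> j != 0 -> j * f r != 0) ->
  zero_divisors A x -> zero_divisors R (val x).1.
Proof.
move=> regJ [y y0 /(congr1 val)]; rewrite val_amalgM val_amalg0.
have /asboolP[r [i [Ji ->]]] := valP x.
have /asboolP[s [j [Jj ys]]] := valP y.
rewrite ys /= => -[rs0 xy0].
have [s0|s0] := eqVneq s 0; last by exists s.
move: ys xy0; rewrite s0 rmorph0 add0r => ys xy0.
have j0 : j != 0.
  apply: contra_neq y0 => j0; apply: val_inj.
  by rewrite ys j0 val_amalg0.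
apply: contrapT => /regJ /(_ Jj j0) /eqP; apply.
by move: xy0; rewrite mulrDl (J_sq0 i j) // addr0 mulrC.
Qed.

Lemma square_zero_amalg :
  square_zero (zero_divisors R) ->
  (forall (r : R) (j : S), regular_elements R r ->
     j \in J -> j != 0 -> j * f r != 0) ->
  (forall (r : R) (j : S), zero_divisors R r -> r != 0 ->
     j \in J -> j != 0 -> j * f r = 0) ->
  square_zero (zero_divisors A).
Proof.
move=> ZR0 regJ killJ x y.
move=> /(zero_divisors_amalg_fst _ regJ) + /(zero_divisors_amalg_fst _ regJ).
have kill r j : zero_divisors R r -> j \in J -> j * f r = 0.
  move=> Zr Jj; have [->|r0] := eqVneq r 0; first by rewrite rmorph0 mulr0.
  by have [->|j0] := eqVneq j 0; [rewrite mul0r | apply: killJ].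
have /asboolP[r [i [Ji xE]]] := valP x.
have /asboolP[s [j [Jj yE]]] := valP y.
rewrite xE yE /= => Zr Zs; apply: val_inj; rewrite val_amalgM val_amalg0 xE yE.
rewrite /= ZR0 // mulrDl !mulrDr -rmorphM ZR0 // rmorph0.
by rewrite (mulrC _ j) !kill // (J_sq0 i j) // !addr0.
Qed.

Lemma square_zero_amalg_inv :
  square_zero (zero_divisors A) ->
  [/\ square_zero (zero_divisors R),
      forall (r : R) (j : S), regular_elements R r ->
        j \in J -> j != 0 -> j * f r != 0
    & forall (r : R) (j : S), zero_divisors R r -> r != 0 ->
        j \in J -> j != 0 -> j * f r = 0].
Proof.
move=> ZA0; split.
- move=> r s /zero_divisors_amalg_diag Zr /zero_divisors_amalg_diag Zs.
  have /(congr1 val) := ZA0 _ _ Zr Zs.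
  by rewrite val_amalgM val_amalg0 !val_amalg_diag => -[].
- move=> r j reg_r Jj j0; apply/eqP => jr0; apply: reg_r.
  apply: zero_divisors_sqr0.
  have Zr : zero_divisors A (amalg_diag r).
    by exists (amalg_ideal j Jj); [apply: amalg_ideal_neq0 | apply: amalg_diagM_ideal].
  have /(congr1 val) := ZA0 _ _ Zr Zr.
  by rewrite val_amalgM val_amalg0 !val_amalg_diag => -[].
- move=> r j /zero_divisors_amalg_diag Zr _ Jj _.
  have Zj := zero_divisors_sqr0 _ _ (amalg_ideal_sqr0 j Jj).
  have /(congr1 val) := ZA0 _ _ Zr Zj.
  rewrite val_amalgM val_amalg0 val_amalg_diag val_amalg_ideal => -[_ /=].
  by rewrite mulrC.
Qed.

End Amalgamation.

Theorem proposition3p3 (R S : comNzRingType) (f : {rmorphism R -> S})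
    (J : idealr S)
    (J_neq0 : exists2 j : S, j \in J & j != 0)
    (J_sq0 : square_zero [set` J]) :
  [<-> complete_graph (zero_divisor_graph (amalg f J));
       [/\ square_zero (zero_divisors R),
           forall (r : R) (j : S), regular_elements R r ->
             j \in J -> j != 0 -> j * f r != 0
         & forall (r : R) (j : S), zero_divisors R r -> r != 0 ->
             j \in J -> j != 0 -> j * f r = 0];
       square_zero (zero_divisors (amalg f J))].
Proof.
tfae.
- case: J_neq0 => j Jj j0 complA; apply: square_zero_amalg_inv => //.
  apply: complete_graph_square_zero complA.
    exact: (amalg_ideal_neq0 _ _ f J j Jj).
  exact: amalg_ideal_sqr0.
- by case; apply: square_zero_amalg.
- exact: square_zero_complete_graph.
Qed.
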